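(* (Symmetric sum formula) Let $\mathbf{k}=(k_1,\ldots,k_n)$ be a sequence of integers with all $k_i\ge2$. Then $$\sum_{\sigma\in S_n}\zeta^t(k_{\sigma(1)},\ldots,k_{\sigma(n)})=\sum_{\Pi=\{P_1,\ldots,P_i\}\in\mathcal{P}_n}c_\Pi(t)\prod_{j=1}^i\zeta\Big(\sum_{l\in P_j}k_l\Big).$$
   Context: For positive integers $k_1\ge2,k_2,\ldots,k_n$, $\zeta(k_1,\ldots,k_n)=\sum_{m_1>m_2>\cdots>m_n>0}m_1^{-k_1}\cdots m_n^{-k_n}$, and the interpolated multiple zeta value is the polynomial $\zeta^t(k_1,\ldots,k_n)=\sum_{\mathbf{p}}t^{n-\mathrm{dep}(\mathbf{p})}\zeta(\mathbf{p})\in\mathbb{R}[t]$, where $\mathbf{p}$ runs over the $2^{n-1}$ sequences $(k_1\,\square\,k_2\,\square\cdots\square\,k_n)$ obtained by replacing each $\square$ by either a comma or a plus sign, and $\mathrm{dep}(\mathbf{p})$ is the length of $\mathbf p$. $S_n$ is the symmetric group, $\mathcal{P}_n$ the set of set partitions of $\{1,\ldots,n\}$, $c_m(t)=(m-1)![t^m-(t-1)^m]$ for $m\ge1$, and $c_\Pi(t)=\prod_{j}c_{\#P_j}(t)$ for $\Pi=\{P_1,\ldots,P_i\}$. *)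

(* Defs.v *)
From HB Require Import structures.
From mathcomp Require Import all_boot all_order all_algebra all_fingroup.
From mathcomp Require Import all_classical all_reals.
From mathcomp Require Import topology normedtype sequences.
Set Implicit Arguments. Unset Strict Implicit. Unset Printing Implicit Defensive.
Import Order.TTheory GRing.Theory Num.Theory.
Import numFieldNormedType.Exports.
Local Open Scope ring_scope.

Section MZV.
Variable R : realType.

(* Truncated multiple zeta sum:
   mzv_trunc N (k1,...,kn) = sum_{N >= m1 > m2 > ... > mn > 0} m1^-k1 ... mn^-kn. *)
Fixpoint mzv_trunc (N : nat) (k : seq nat) : R :=
  match k with
  | [::] => 1
  | k1 :: ks => \sum_(1 <= m < N.+1) (m%:R ^+ k1)^-1 * mzv_trunc m.-1 ks
  end.

Definition mzv (k : seq nat) : R := limn (fun N => mzv_trunc N k).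

(* contract b k: b = [:: b1; ...; b_{n-1}] chooses, for each box between
   k_i and k_{i+1}, a plus sign (true) or a comma (false). *)
Fixpoint contract (b : seq bool) (k : seq nat) : seq nat :=
  match b, k with
  | c :: bs, x :: y :: ks =>
      if c then contract bs ((x + y) :: ks) else x :: contract bs (y :: ks)
  | _, _ => k
  end.

Definition mzv_t (k : seq nat) : {poly R} :=
  \sum_(b : (size k).-1.-tuple bool)
     'X ^+ (size k - size (contract b k)) * (mzv (contract b k))%:P.

Definition cm (m : nat) : {poly R} :=
  (m.-1)`!%:R *: ('X ^+ m - ('X - 1) ^+ m).

Definition cPi (n : nat) (P : {set {set 'I_n}}) : {poly R} :=
  \prod_(B in P) cm #|B|.

End MZV.

(* Main.v *)
Require Import Defs.
From HB Require Import structures.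
From mathcomp Require Import all_boot all_order all_algebra all_fingroup.
From mathcomp Require Import ring lra.
Set Implicit Arguments. Unset Strict Implicit. Unset Printing Implicit Defensive.
Import Order.TTheory GRing.Theory Num.Theory.
Local Open Scope ring_scope.

(** Truncate all zeta values at m <= N; the identity already holds for the
    truncations, and N is then sent to infinity coefficient by coefficient.

    The truncated zeta^t is a sum over weakly decreasing chains of indices, with
    weight t^(number of ties).  Symmetrising it over the orderings of a set A
    gives a set function Z_N(A), and splitting off the set B of positions whose
    index is N yields Z_N(A) = sum_B |B|! t^(|B|-1) N^(-k_B) Z_(N-1)(A \ B),
    the sum of B over the subsets of A.  In the algebra of set functions under
    this convolution, the sum over set partitions of A of the products of w(B)
    is exp(w), and B |-> |B|! t^(|B|-1) N^(-k_B) is the exponential of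
    B |-> c_|B|(t) N^(-k_B).  Hence Z_N is the exponential of
    B |-> c_|B|(t) sum_(m <= N) m^(-k_B). *)

(** * Set functions under convolution, and exponentials over set partitions *)

Section SetFunctions.
Variables (I : finType) (S : comNzRingType).
Implicit Types (A B C D : {set I}) (F G w : {set I} -> S).

Definition set_conv F G A := \sum_(B : {set I} | B \subset A) F B * G (A :\: B).

(* F is a multiple of exp(w): differentiating exp(w) in the direction i keeps
   the blocks that contain i. *)
Definition set_logder F w :=
  forall A i, i \in A ->
    F A = \sum_(C : {set I} | (C \subset A) && (i \in C)) w C * F (A :\: C).

Definition partition_sum w A :=
  \sum_(P : {set {set I}} | partition P A) \prod_(B in P) w B.

(** Every [C] contains [i], so [A :\: C] is smaller than [A] and the equation is a recursion on
    [#|A|]. *)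
Lemma set_logder_unique F G w :
  set_logder F w -> set_logder G w -> F set0 = G set0 -> F =1 G.
Proof.
move=> dF dG FG0 A; have [m leAm] := ubnP #|A|.
elim: m A leAm => // m IHm A leAm.
have [->//|[i Ai]] := set_0Vmem A.
rewrite (dF A i Ai) (dG A i Ai); apply: eq_bigr => C /andP[sCA Ci].
rewrite IHm //; apply: leq_trans (_ : #|A| <= m)%N => //.
by apply/proper_card/properP; split; [exact: subsetDl|exists i; rewrite // inE Ci].
Qed.

(** Leibniz rule: according to whether [i] lies in [B], the block [C] through [i] is taken out of
    [B] or out of [A :\: B]. *)
Lemma set_logder_conv F G w w' :
  set_logder F w -> set_logder G w' ->
  set_logder (set_conv F G) (fun B => w B + w' B).
Proof.
move=> dF dG A i Ai; rewrite /set_conv.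
under [RHS]eq_bigr do rewrite mulrDl.
rewrite (bigID (fun B : {set I} => i \in B)) big_split /=; congr (_ + _).
  under eq_bigr => B /andP[sBA Bi] do rewrite (dF B i Bi) mulr_suml.
  rewrite (exchange_big_dep (fun C : {set I} => (C \subset A) && (i \in C))) /=; last first.
    by move=> B C /andP[sBA _] /andP[sCB ->]; rewrite (subset_trans sCB).
  apply: eq_bigr => C /andP[sCA Ci]; rewrite mulr_sumr.
  rewrite (reindex_onto (fun D => C :|: D) (fun B => B :\: C)) /=; last first.
    by move=> B /andP[_ /andP[sCB _]]; rewrite setDE setUIr setUCr setIT; apply/setUidPr.
  apply: eq_big => [D|D].
    rewrite subUset sCA inE Ci subsetUl /= !andbT setDUl setDv set0U subsetD.
    by congr (_ && _); apply/eqP/setDidPl.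
  case/andP=> _ /eqP ->; rewrite mulrA; congr (_ * G _).
  by rewrite setDDl.
under eq_bigr => B /andP[sBA Bi].
  rewrite (dG (A :\: B) i) ?inE ?Bi //.
  rewrite mulr_sumr.
  over.
rewrite (exchange_big_dep (fun C : {set I} => (C \subset A) && (i \in C))) /=; last first.
  by move=> B C _ /andP[/subset_trans->//]; rewrite subsetDl.
apply: eq_bigr => C /andP[sCA Ci]; rewrite mulr_sumr; apply: eq_big => [B|B].
  rewrite Ci andbT andbAC !subsetD sCA /= disjoint_sym.
  case: (B \subset A) => //=; case dBC: [disjoint B & C] => //=.
  by rewrite (disjointFl dBC Ci).
by move=> _; rewrite mulrCA !setDDl (setUC C).
Qed.

Lemma partition_sum0 w : partition_sum w set0 = 1.
Proof.
rewrite /partition_sum (big_pred1 set0) ?big_set0 // => P.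
by rewrite partition_set0.
Qed.

(** Group the partitions by their block [C] through [i]; deleting [C] leaves an arbitrary partition
    of [A :\: C]. *)
Lemma partition_sum_logder w : set_logder (partition_sum w) w.
Proof.
move=> A i Ai; rewrite /partition_sum.
rewrite (partition_big (fun P => pblock P i)
  (fun C => (C \subset A) && (i \in C))) /=; last first.
  move=> P partP; have cA := cover_partition partP.
  rewrite mem_pblock cA Ai andbT -cA.
  by apply: (bigcup_max (pblock P i)); rewrite // pblock_mem // cA.
apply: eq_bigr => C /andP[sCA Ci]; rewrite mulr_sumr.
have C0 : C != set0 by apply/set0Pn; exists i.
rewrite (reindex_onto (fun Q => C |: Q) (fun P => P :\ C)) /=; last first.
  move=> P /andP[partP /eqP PC]; apply: setD1K; rewrite -PC.
  by rewrite pblock_mem // (cover_partition partP).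
apply: eq_big => [Q|Q /andP[/andP[partP _] /eqP QC]]; last first.
  by rewrite big_setU1 //= -QC !inE eqxx.
apply/andP/idP => [[/andP[partP _] /eqP QC]|partQ].
  by rewrite -QC; apply: partitionD1 => //; rewrite setU11.
have CQ : C \notin Q.
  apply/negP => CQ; have /subsetP/(_ i Ci) : C \subset A :\: C.
    by rewrite -(cover_partition partQ); apply: bigcup_max CQ _.
  by rewrite inE Ci.
have partP : partition (C |: Q) A.
  rewrite -(setID A C) (setIidPr sCA); apply: partitionU1 => //.
  by rewrite -setI_eq0 setIDA setD_eq0 subsetIl.
rewrite partP setU1K // eqxx; split=> //=; apply/eqP.
by apply: def_pblock; rewrite ?setU11 //; case/and3P: partP.
Qed.

End SetFunctions.

(** * The coefficients c_m(t) as logarithm of m! t^(m-1) *)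

Section BlockCoefficients.
Variables (S : comNzRingType) (t : S).

Definition block_coef m : S := (m.-1)`!%:R * (t ^+ m - (t - 1) ^+ m).

(** Orderings of m tied positions, weighted by their m-1 ties; the value 1 at 0 is the constant term
    of the exponential. *)
Definition tie_coef m : S := if m is m'.+1 then m`!%:R * t ^+ m' else 1.

(** The products (t-1)^(j+1) t^(n-j-1) form a geometric sum, which closes without a denominator
    because t - (t-1) = 1. *)
Lemma sum_pow_diff n :
  \sum_(j < n) (t ^+ j.+1 - (t - 1) ^+ j.+1) * t ^+ (n - j.+1)
  + (t ^+ n.+1 - (t - 1) ^+ n.+1) = n.+1%:R * t ^+ n.
Proof.
elim: n => [|n IHn]; first by rewrite big_ord0 !expr1 expr0; ring.
have -> : \sum_(j < n.+1) (t ^+ j.+1 - (t - 1) ^+ j.+1) * t ^+ (n.+1 - j.+1)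
    = t * (\sum_(j < n) (t ^+ j.+1 - (t - 1) ^+ j.+1) * t ^+ (n - j.+1))
      + (t ^+ n.+1 - (t - 1) ^+ n.+1).
  rewrite big_ord_recr /= subnn expr0 mulr1 mulr_sumr; congr (_ + _).
  by apply: eq_bigr => j _; rewrite subSn ?ltn_ord // (exprS t (n - _)) mulrCA.
move/(canRL (addrK _)): IHn => ->.
by rewrite -(natr1 n.+1) !exprS; ring.
Qed.

(* The coefficient form of exp(sum_m c_m u^m / m!) = (1 - (t-1)u) / (1 - tu),
   after differentiating in u. *)
Lemma tie_coef_rec n :
  tie_coef n.+1
  = \sum_(j < n.+1) 'C(n, j)%:R * (block_coef j.+1 * tie_coef (n - j)).
Proof.
rewrite big_ord_recr /= subnn binn mul1r mulr1 /block_coef /=.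
rewrite factS natrM mulrAC -sum_pow_diff mulrDl mulr_suml [X in _ = _ + X]mulrC; congr (_ + _).
apply: eq_bigr => j _; have ltjn := ltn_ord j.
by rewrite -(bin_fact (ltnW ltjn)) !natrM -(subnSK ltjn) /tie_coef; ring.
Qed.

Variable I : finType.
Implicit Types A B C D : {set I}.

Lemma sum_subset_card (f : nat -> S) A :
  \sum_(D : {set I} | D \subset A) f #|D|
  = \sum_(j < #|A|.+1) 'C(#|A|, j)%:R * f j.
Proof.
rewrite (partition_big (fun D => inord #|D| : 'I_(#|A|.+1)) xpredT) //=.
apply: eq_bigr => j _; rewrite -cards_draws mulr_natl -sumr_const.
have cardE D : D \subset A -> (inord #|D| == j) = (#|D| == j).
  by move=> sDA; rewrite -val_eqE /= inordK // ltnS subset_leq_card.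
apply: eq_big => [D|D /andP[sDA]]; first by rewrite inE; case: (boolP (_ \subset _)) => //= /cardE.
by rewrite cardE // => /eqP->.
Qed.

Lemma sum_subset_mem (f : {set I} -> S) A i : i \in A ->
  \sum_(C : {set I} | (C \subset A) && (i \in C)) f C
  = \sum_(D : {set I} | D \subset A :\ i) f (i |: D).
Proof.
move=> Ai; rewrite (reindex_onto (fun D => i |: D) (fun C => C :\ i)) /=; last first.
  by move=> C /andP[_ Ci]; rewrite setD1K.
apply: eq_bigl => D; rewrite subUset sub1set Ai setU11 andbT /= subsetD1; congr (_ && _).
apply/eqP/idP => [<-|]; last exact: setU1K.
by rewrite !inE eqxx.
Qed.

(** The products of [y] over [C] and [A :\: C] recombine, so only cardinalities matter; counting the
    sets [C] through [i] by size gives the binomials of [tie_coef_rec]. *)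
Lemma tie_coef_logder (y : I -> S) :
  set_logder (fun A => tie_coef #|A| * \prod_(i in A) y i)
             (fun A => block_coef #|A| * \prod_(i in A) y i).
Proof.
move=> A i Ai; transitivity
  (\sum_(C : {set I} | (C \subset A) && (i \in C))
      block_coef #|C| * tie_coef (#|A| - #|C|) * \prod_(l in A) y l).
  rewrite -mulr_suml; congr (_ * _).
  rewrite (sum_subset_mem (fun C => block_coef #|C| * tie_coef (#|A| - #|C|)) Ai).
  rewrite (cardsD1 i A) Ai tie_coef_rec.
  rewrite -(sum_subset_card (fun j => block_coef j.+1 * tie_coef (#|A :\ i| - j))).
  apply: eq_bigr => D; rewrite subsetD1 => /andP[_ iD].
  by rewrite cardsU1 iD !add1n subSS.
apply: eq_bigr => C /andP[sCA _].
rewrite (big_setID C) /= (setIidPr sCA) cardsD (setIidPr sCA); ring.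
Qed.

End BlockCoefficients.

(** * Sums over all orderings of a set *)

Section SymmetricSums.
Variables (I : finType) (S : comNzRingType).
Implicit Types A B : {set I}.

(** Lists, unlike permutations of the whole type, let [A] shrink when the first entry is removed. *)
Definition sym_sum (F : seq I -> S) A := \sum_(s <- permutations (enum A)) F s.

Lemma sym_sum0 F : sym_sum F set0 = F [::].
Proof. by rewrite /sym_sum enum_set0 big_seq1. Qed.

Lemma sym_sumS F A : A != set0 ->
  sym_sum F A = \sum_(i in A) sym_sum (fun s => F (i :: s)) (A :\ i).
Proof.
move=> A0; rewrite /sym_sum (perm_big _ (permutationsE _)) /=; last first.
  by rewrite -cardE card_gt0.
rewrite undup_id ?enum_uniq // big_allpairs_dep /= big_enum /=.
apply: eq_bigr => i Ai; apply: perm_big; apply: perm_permutations.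
apply: uniq_perm; rewrite ?rem_uniq ?enum_uniq // => j.
by rewrite mem_rem_uniq ?enum_uniq // !inE !mem_enum !inE.
Qed.

Lemma sum_perm_sym (F : seq I -> S) :
  \sum_(s : {perm I}) F [seq s i | i <- enum I] = sym_sum F [set: I].
Proof.
rewrite /sym_sum enum_setT -enumT.
rewrite -[LHS](big_map (fun s : {perm I} => [seq s i | i <- enum I]) xpredT F).
apply: perm_big; apply: uniq_perm.
- rewrite map_inj_uniq ?index_enum_uniq // => s1 s2 /eq_in_map eqs.
  by apply/permP => i; apply: eqs; rewrite mem_enum.
- exact: permutations_uniq.
move=> u; rewrite mem_permutations; apply/mapP/idP => [[s _ ->]|pu].
  apply: uniq_perm; rewrite ?(map_inj_uniq (@perm_inj _ s)) ?enum_uniq //.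
  move=> i; rewrite mem_enum inE; apply/mapP; exists ((s^-1)%g i); rewrite ?mem_enum //.
  by rewrite permKV.
have szu : size u = #|I| by rewrite (perm_size pu) -cardE.
have uu : uniq u by rewrite (perm_uniq pu) enum_uniq.
(* The default [i] is never reached, since [u] has length [#|I|]. *)
pose f i := nth i u (enum_rank i).
have finj : injective f.
  move=> i j; rewrite /f (set_nth_default j) ?szu ?ltn_ord // => /eqP.
  by rewrite nth_uniq ?szu // => /eqP/val_inj/enum_rank_inj.
exists (perm finj); first by rewrite mem_index_enum.
case: (pickP I) => [i0 _|I0]; last first.
  have I0' : #|I| = 0%N by apply: eq_card0.
  by rewrite (size0nil (etrans szu I0')); apply/esym/size0nil; rewrite size_map -cardE.
apply: (@eq_from_nth _ i0) => [|m]; first by rewrite size_map -cardE.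
rewrite szu => ltm.
rewrite (nth_map i0) -?cardE // permE -(enum_val_nth i0 (Ordinal ltm)) /f enum_valK.
by apply: set_nth_default; rewrite szu.
Qed.

End SymmetricSums.

(** * Weakly decreasing chains weighted by ties *)

Section WeakChains.
Variables (I : Type) (S : comNzRingType) (t : S) (x : nat -> I -> S).

(* Sum over chains m = m_1 >= m_2 >= ... >= m_n of t^(number of ties) times the
   product of the x m_l s_l; the inner sum below runs over m_2 < m. *)
Fixpoint chain_at (s : seq I) (m : nat) : S :=
  if s is i :: s' then
    x m i * (t * chain_at s' m + ((nilp s')%:R + \sum_(j < m) chain_at s' j))
  else 0.

(** The empty chain has no top index; the [nilp] term counts it. *)
Definition chain_sum (s : seq I) (N : nat) : S :=
  (nilp s)%:R + \sum_(j < N) chain_at s j.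

Lemma chain_sumS s N : chain_sum s N.+1 = chain_sum s N + chain_at s N.
Proof. by rewrite /chain_sum big_ord_recr /= addrA. Qed.

End WeakChains.

(** * Symmetrised chain sums as exponentials *)

Section SymmetricChains.
Variables (I : finType) (S : comNzRingType) (t : S) (x : nat -> I -> S).
Implicit Types A B : {set I}.

Let SV A m := sym_sum (fun s => chain_at t x s m) A.
Let SZ A m := sym_sum (fun s => chain_sum t x s m) A.

Lemma sym_chain_at_rec A m :
  SV A m = \sum_(i in A) x m i * (t * SV (A :\ i) m + SZ (A :\ i) m).
Proof.
have [->|A0] := eqVneq A set0; first by rewrite /SV sym_sum0 big_set0.
rewrite /SV sym_sumS //; apply: eq_bigr => i Ai.
by rewrite /SZ /sym_sum mulr_sumr -big_split mulr_sumr.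
Qed.

(** [B] collects the elements whose index equals [m]: they open the chain, in any of [#|B|]
    factorial orders, and the remaining indices are below [m]. *)
Lemma sym_chain_atE A m :
  SV A m = \sum_(B : {set I} | (B \subset A) && (B != set0))
             tie_coef t #|B| * (\prod_(i in B) x m i) * SZ (A :\: B) m.
Proof.
have [n leAn] := ubnP #|A|; elim: n A leAn => // n IHn A leAn.
rewrite sym_chain_at_rec.
(* [g B] is the share of [B] with its first element fixed; summing over that element restores the
   full factorial. *)
pose g B := t ^+ #|B|.-1 * (#|B|.-1)`!%:R * (\prod_(l in B) x m l) * SZ (A :\: B) m.
transitivity (\sum_(i in A) \sum_(B : {set I} | (B \subset A) && (i \in B)) g B).
  apply: eq_bigr => i Ai; rewrite IHn; last first.
    by rewrite -ltnS; apply: leq_trans leAn; rewrite (cardsD1 i A) Ai.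
  rewrite (sum_subset_mem _ Ai) [RHS](bigD1 set0) ?sub0set //= {1}/g.
  rewrite setU0 cards1 big_set1 expr0 mul1r fact0 mul1r mulrDr addrC; congr (_ + _).
  rewrite mulrA mulr_sumr; apply: eq_bigr => D /andP[]; rewrite subsetD1 => /andP[sDA iD].
  rewrite -card_gt0 /g cardsU1 iD big_setU1 //= setDDl.
  by case: #|D| => // r _; rewrite /tie_coef exprS; ring.
rewrite (exchange_big_dep (fun B => (B \subset A) && (B != set0))) /=; last first.
  by move=> i B Ai /andP[-> Bi]; apply/set0Pn; exists i.
apply: eq_bigr => B /andP[sBA B0].
rewrite (eq_bigl (mem B)); last first.
  by move=> i; rewrite sBA /=; apply: andb_idl; apply: subsetP.
rewrite sumr_const -mulr_natl !mulrA; congr (_ * _ * _).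
rewrite -card_gt0 in B0; case: #|B| B0 => // r _.
by rewrite /tie_coef factS natrM /=; ring.
Qed.

Lemma sym_chain_sumS A N :
  SZ A N.+1 = set_conv (fun B => tie_coef t #|B| * \prod_(i in B) x N i)
                       (fun B => SZ B N) A.
Proof.
rewrite /set_conv (bigD1 set0) ?sub0set //=.
rewrite cards0 big_set0 !mul1r setD0 -sym_chain_atE /SZ /SV /sym_sum -big_split.
by apply: eq_bigr => s _; rewrite chain_sumS.
Qed.

(** Admitting the index [N] convolves with one more exponential, so the logarithms add up over the
    indices. *)
Lemma sym_chain_sum_partition A N :
  SZ A N = partition_sum (fun B =>
     block_coef t #|B| * \sum_(m < N) \prod_(i in B) x m i) A.
Proof.
suff: [/\ SZ set0 N = 1 &
    set_logder (fun B => SZ B N) (fun B =>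
      block_coef t #|B| * \sum_(m < N) \prod_(i in B) x m i)].
  case=> Z1 dZ; apply: (set_logder_unique dZ); first exact: partition_sum_logder.
  by rewrite Z1 partition_sum0.
split.
  rewrite /SZ sym_sum0 /chain_sum big1 ?addr0 //.
elim: N => [|N IHN].
  (* With no index available a nonempty set carries no chain, and both sides vanish. *)
  move=> B i Bi; rewrite big1 => [|C _]; last by rewrite big_ord0 mulr0 mul0r.
  rewrite /SZ /sym_sum big_seq big1 // => s; rewrite mem_permutations => /perm_size.
  rewrite /chain_sum big_ord0 addr0 /nilp => ->.
  by rewrite -cardE (cardD1 i) Bi.
move=> B i Bi; rewrite sym_chain_sumS (set_logder_conv (tie_coef_logder _ _) IHN Bi).
by apply: eq_bigr => C _; rewrite sym_chain_sumS big_ord_recr /= addrC mulrDr.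
Qed.

End SymmetricChains.

From mathcomp Require Import all_classical all_reals.
From mathcomp Require Import topology normedtype sequences.
Import Order.TTheory GRing.Theory Num.Theory.
Import numFieldNormedType.Exports.
Local Open Scope ring_scope.

(* The analysis library has another constant named contract. *)
Local Notation contract := Defs.contract.

(** * Contractions of exponent sequences *)

Lemma sum_tuple_boolS (V : nmodType) n (f : seq bool -> V) :
  \sum_(b : n.+1.-tuple bool) f b
  = \sum_(b : n.-tuple bool) (f (true :: b) + f (false :: b)).
Proof.
rewrite big_split (reindex (fun p : bool * n.-tuple bool => [tuple of p.1 :: p.2])) /=.
  rewrite -(pair_bigA _ (fun c (b : n.-tuple bool) => f (c :: b))) /=.
  by rewrite big_bool.
exists (fun b => (thead b, [tuple of behead b])) => [[c b] _|b _] /=.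
  by congr pair; apply: val_inj.
by rewrite [RHS]tuple_eta; apply: val_inj.
Qed.

(** The first exponent is only ever added to, so [h] and [ks'] do not depend on [x]. *)
Lemma contract_cons bs y ks :
  exists h ks', (size ks' <= size ks)%N /\
    forall x, contract bs ((x + y)%N :: ks) = (x + h)%N :: ks'.
Proof.
elim: bs y ks => [|c bs IH] y ks; first by exists y, ks.
case: ks => [|z ks]; first by exists y, [::].
case: c => /=; last first.
  have [h [ks' [le_ks' E]]] := IH z ks.
  exists y, (contract bs (z :: ks)); split=> //.
  by have := E 0%N; rewrite !add0n => ->.
have [h [ks' [le_ks' E]]] := IH (y + z)%N ks.
exists h, ks'; split=> [|x]; first exact: leqW.
by rewrite -E addnA.
Qed.

Lemma contract_ge2 bs ks :
  all (leq 2) ks -> all (leq 2) (contract bs ks).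
Proof.
elim: bs ks => [|c bs IH] [|x [|y ks]] //=.
case/and3P => x2 y2 ks2; case: c => /=; last by rewrite x2 IH //= y2.
by apply: IH; rewrite /= ks2 (leq_trans x2) ?leq_addr.
Qed.

(** * Truncated interpolated zeta values as chain sums *)

Section Truncation.
Variable R : realType.
Implicit Types ks : seq nat.

(* Indices are shifted by one: the largest summation index is m + 1. *)
Definition mzv_at (m : nat) ks : R :=
  if ks is k :: ks' then (m.+1%:R ^+ k)^-1 * mzv_trunc R m ks' else 0.

Lemma mzv_truncE N ks :
  mzv_trunc R N ks = (nilp ks)%:R + \sum_(m < N) mzv_at m ks.
Proof.
case: ks => [|k ks] /=; first by rewrite big1 ?addr0.
by rewrite big_add1 /= big_mkord add0r.
Qed.

(** [mzv_t] is the case of [mzv]; a free [F] also covers truncations and sums with a fixed largest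
    index. *)
Definition mzv_t_with (F : seq nat -> R) ks : {poly R} :=
  \sum_(b : (size ks).-1.-tuple bool)
     'X ^+ (size ks - size (contract b ks)) * (F (contract b ks))%:P.

Definition inv_pow (m k : nat) : {poly R} := ((m.+1%:R ^+ k)^-1)%:P.

Lemma mzv_t_with_trunc N ks :
  mzv_t_with (mzv_trunc R N) ks
  = (nilp ks)%:R + \sum_(m < N) mzv_t_with (mzv_at m) ks.
Proof.
rewrite exchange_big /=.
case: ks => [|k ks]; rewrite /mzv_t_with.
  rewrite (eq_bigr (fun=> 1)); last first.
    by move=> b _; case: (val b) => [|c bs] /=; rewrite expr0 mul1r.
  rewrite sumr_const card_tuple expn0 big1 ?addr0 // => b _.
  by rewrite big1 // => m _; case: (val b) => [|c bs] /=; rewrite mulr0.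
rewrite add0r; apply: eq_bigr => b _.
have [h [ks' [_ /(_ 0%N)]]] := contract_cons b k ks; rewrite !add0n => ->.
by rewrite mzv_truncE add0r rmorph_sum mulr_sumr.
Qed.

(** A plus in the first box is a tie: two exponents share an index and the lost depth gives ['X]. A
    comma makes the next index strictly smaller. *)
Lemma chain_at_mzv m ks :
  mzv_t_with (mzv_at m) ks = chain_at 'X inv_pow ks m.
Proof.
elim: ks m => [|k [|l ks] IH] m.
- by rewrite /mzv_t_with big1 // => b _; case: (val b) => [|c bs] /=; rewrite mulr0.
- rewrite /mzv_t_with /= (eq_bigr (fun=> inv_pow m k)); last first.
    by move=> b _; case: (val b) => [|c bs] /=; rewrite expr0 mul1r mulr1.
  by rewrite sumr_const card_tuple expn0 mulr0 add0r big1 ?addr0 ?mulr1.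
transitivity (inv_pow m k * ('X * mzv_t_with (mzv_at m) (l :: ks)
                   + mzv_t_with (mzv_trunc R m) (l :: ks))); last first.
  rewrite mzv_t_with_trunc IH; congr (_ * (_ + (_ + _))).
  by apply: eq_bigr => j _; rewrite IH.
rewrite {1}/mzv_t_with /= (sum_tuple_boolS _ (fun b =>
  'X ^+ ((size ks).+2 - size (contract b [:: k, l & ks]))
  * (mzv_at m (contract b [:: k, l & ks]))%:P)).
rewrite big_split mulrDr /mzv_t_with !mulr_sumr; congr (_ + _).
  apply: eq_bigr => b _ /=.
  have [h [ks' [le_ks' E]]] := contract_cons b l ks.
  have := E 0%N; rewrite !add0n => ->; rewrite (E k) /=.
  rewrite !subSS subSn // exprS /inv_pow exprD invfM !rmorphM /=; ring.
apply: eq_bigr => b _ /=.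
by rewrite subSS rmorphM /= /inv_pow; ring.
Qed.

Lemma mzv_t_with_chain_sum N ks :
  mzv_t_with (mzv_trunc R N) ks = chain_sum 'X inv_pow ks N.
Proof.
rewrite mzv_t_with_trunc; congr (_ + _).
by apply: eq_bigr => m _; rewrite chain_at_mzv.
Qed.

Lemma chain_at_map (I : Type) (k : I -> nat) s m :
  chain_at 'X inv_pow (map k s) m = chain_at 'X (fun m i => inv_pow m (k i)) s m.
Proof.
elim: s m => //= i s IH m; rewrite IH /nilp size_map; congr (_ * (_ + (_ + _))).
by apply: eq_bigr => j _; rewrite IH.
Qed.

Lemma chain_sum_map (I : Type) (k : I -> nat) s N :
  chain_sum 'X inv_pow (map k s) N = chain_sum 'X (fun m i => inv_pow m (k i)) s N.
Proof.
rewrite /chain_sum /nilp size_map; congr (_ + _).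
by apply: eq_bigr => m _; rewrite chain_at_map.
Qed.

Lemma block_coefE m : block_coef 'X m = cm R m.
Proof. by rewrite /cm scaler_nat /block_coef mulr_natl. Qed.

Lemma truncated_symmetric_sum N n (k : 'I_n -> nat) :
  \sum_(s : 'S_n) mzv_t_with (mzv_trunc R N) [seq k (s i) | i <- enum 'I_n]
  = \sum_(P : {set {set 'I_n}} | finset.partition P [set: 'I_n])
      cPi R P * (\prod_(B in P) mzv_trunc R N [:: \sum_(l in B) k l]%N)%:P.
Proof.
under eq_bigr => s _ do rewrite map_comp mzv_t_with_chain_sum chain_sum_map.
rewrite (sum_perm_sym (fun s => chain_sum 'X (fun m i => inv_pow m (k i)) s N)).
rewrite sym_chain_sum_partition; apply: eq_bigr => P _.
rewrite rmorph_prod /cPi -big_split; apply: eq_bigr => B _ /=.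
rewrite block_coefE big_add1 /= big_mkord rmorph_sum; congr (_ * _).
apply: eq_bigr => m _; rewrite mulr1 -rmorph_prod; congr (_%:P).
by rewrite prodfV prodrXr.
Qed.

End Truncation.

(** * Convergence of the truncations *)

Section Convergence.
Local Open Scope classical_set_scope.
Variable R : realType.

Lemma mzv_trunc_ge0 N ks : 0 <= mzv_trunc R N ks.
Proof.
elim: ks N => [|k ks IH] N //=.
by apply: sumr_ge0 => m _; rewrite mulr_ge0 // invr_ge0 exprn_ge0.
Qed.

Lemma mzv_trunc_nondecreasing ks :
  nondecreasing_seq (fun N => mzv_trunc R N ks).
Proof.
apply/nondecreasing_seqP => N; case: ks => //= k ks.
rewrite [leRHS]big_nat_recr //= lerDl mulr_ge0 ?mzv_trunc_ge0 //.
by rewrite invr_ge0 exprn_ge0.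
Qed.

Lemma sum_inv_sqr_le2 N : \sum_(1 <= m < N.+1) ((m%:R : R) ^+ 2)^-1 <= 2.
Proof.
(* This sharper bound is inductive, as 1/(y+1)^2 <= 1/y - 1/(y+1). *)
suff H : \sum_(1 <= m < N.+2) ((m%:R : R) ^+ 2)^-1 <= 2 - N.+1%:R^-1.
  apply: le_trans (_ : 2 - N.+1%:R^-1 <= 2); last by rewrite gerBl invr_ge0.
  by apply: le_trans H; rewrite [leRHS]big_nat_recr //= lerDl invr_ge0 exprn_ge0.
elim: N => [|N IH]; first by rewrite big_nat1 expr1n invr1; lra.
rewrite big_nat_recr //=.
have N0 : 0 < N.+1%:R :> R by rewrite ltr0n.
have -> : N.+2%:R = N.+1%:R + 1 :> R by rewrite natr1.
set y : R := N.+1%:R in N0 IH *.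
clearbody y.
have y1 : 0 < y + 1 by lra.
suff : ((y + 1) ^+ 2)^-1 <= y^-1 - (y + 1)^-1.
  by move: IH; set u := y^-1; set v := (y + 1)^-1; lra.
have -> : y^-1 - (y + 1)^-1 = (y * (y + 1))^-1 by field; rewrite !gt_eqF.
rewrite lef_pV2 ?posrE ?mulr_gt0 ?exprn_gt0 // expr2.
by rewrite ler_pM2r //; lra.
Qed.

(** Lower each exponent to 2 and bound the inner sums uniformly in their upper limit; each level
    costs a factor 2. *)
Lemma mzv_trunc_le ks N : all (leq 2) ks -> mzv_trunc R N ks <= 2 ^+ size ks.
Proof.
elim: ks N => //= k ks IH N /andP[k2 ks2]; rewrite exprS.
apply: le_trans (_ : (\sum_(1 <= m < N.+1) ((m%:R : R) ^+ 2)^-1) * 2 ^+ size ks <= _).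
  rewrite mulr_suml; apply: ler_sum_nat => m /andP[m1 _].
  have m0 : 0 < m%:R :> R by rewrite ltr0n.
  apply: ler_pM; rewrite ?invr_ge0 ?exprn_ge0 ?mzv_trunc_ge0 ?IH //.
  by rewrite lef_pV2 ?posrE ?exprn_gt0 // ler_weXn2l // ler1n.
by rewrite ler_wpM2r ?exprn_ge0 // sum_inv_sqr_le2.
Qed.

Lemma mzv_trunc_cvg ks : all (leq 2) ks ->
  (fun N => mzv_trunc R N ks) @ \oo --> mzv R ks.
Proof.
move=> ks2; apply: nondecreasing_is_cvgn; first exact: mzv_trunc_nondecreasing.
by exists (2 ^+ size ks) => _ [N _ <-]; apply: mzv_trunc_le.
Qed.

Lemma coef_mulC_cvg (p : {poly R}) (u : R^nat) (l : R) i :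
  u @ \oo --> l -> (p * (u N)%:P)`_i @[N --> \oo] --> (p * l%:P)`_i.
Proof.
move=> ul; rewrite coefMC; under eq_fun do rewrite coefMC.
exact: cvgMl_tmp.
Qed.

Lemma coef_sum_cvg (I : Type) (r : seq I) (P : pred I)
    (f : I -> nat -> {poly R}) (g : I -> {poly R}) i :
  (forall j, P j -> (f j N)`_i @[N --> \oo] --> (g j)`_i) ->
  (\sum_(j <- r | P j) f j N)`_i @[N --> \oo] --> (\sum_(j <- r | P j) g j)`_i.
Proof.
move=> fg; rewrite coef_sum; under eq_fun do rewrite coef_sum.
apply: cvg_big => //; exact: add_continuous.
Qed.

End Convergence.

Theorem theorem3p2 (R : realType) (n : nat) (k : 'I_n -> nat)
  (hk : forall i, (2 <= k i)%N) :
  \sum_(s : 'S_n) mzv_t R [seq k (s i) | i <- enum 'I_n]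
  = \sum_(P : {set {set 'I_n}} | finset.partition P [set: 'I_n])
      cPi R P * (\prod_(B in P) mzv R [:: \sum_(l in B) k l]%N)%:P.
Proof.
apply/polyP => i.
pose u N := (\sum_(s : 'S_n)
  mzv_t_with (mzv_trunc R N) [seq k (s i) | i <- enum 'I_n])`_i.
have u_lhs : (u N @[N --> \oo] -->
    (\sum_(s : 'S_n) mzv_t R [seq k (s i) | i <- enum 'I_n])`_i)%classic.
  apply: coef_sum_cvg => s _; apply: coef_sum_cvg => b _.
  apply: coef_mulC_cvg; apply: mzv_trunc_cvg; apply: contract_ge2.
  by apply/allP => _ /mapP[j _ ->].
(* It remains to see that [u] also tends to the coefficient of the right-hand side. *)
apply: (cvg_unique _ u_lhs) => //.
rewrite (_ : u = fun N => (\sum_(P : {set {set 'I_n}} | finset.partition P [set: 'I_n])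
    cPi R P * (\prod_(B in P) mzv_trunc R N [:: \sum_(l in B) k l]%N)%:P)`_i); last first.
  by apply/funext => N; rewrite /u truncated_symmetric_sum.
apply: coef_sum_cvg => P partP; apply: coef_mulC_cvg.
apply: cvg_big => [|B PB]; first exact: mul_continuous.
apply: mzv_trunc_cvg; rewrite /= andbT.
(* Blocks are nonempty, so the exponent of each block is at least some [k l], hence at least 2. *)
have /set0Pn[l Bl] := partition_neq0 partP PB.
by rewrite (bigD1 l) //= (leq_trans (hk l)) ?leq_addr.
Qed.
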